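(* Let there be $N\ge2$ agents, let $P_f$ be a polymatroid with rank function $f$ on $\mathcal N=\{1,\dots,N\}$ with $f(\mathcal N)=1$ and minimum distance $\triangle f>0$, let $M$ be an integer with $M\ge\frac{2}{\triangle f}$, and let $P_{\tilde f}$ be the integral polymatroid with $\tilde f(S)=\lfloor f(S)M\rfloor$. Let $\alpha,\beta$ be positive constants. Then for all utility functions $u_1,\dots,u_N$ on $[0,1]$ that are nonnegative, concave, strictly increasing and satisfy $\beta<u_n'<\alpha$, the efficiency of the quantized VCG mechanism satisfies $$\frac{\max_{\mathbf y\in P_{\tilde f}}\sum_{n=1}^N u_n(\frac{y_n}{M})}{\max_{\mathbf x\in P_f}\sum_{n=1}^N u_n(x_n)}\ \ge\ \frac{M\beta+2(\alpha-\beta)}{M\alpha+2(\alpha-\beta)-[M-N+1]^+(\alpha-\beta)}.$$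
   Context: A set function $f:2^{\mathcal N}\to\mathbb R$ is a rank function if it is normalized ($f(\emptyset)=0$), monotone ($f(S)\le f(T)$ for $S\subseteq T$) and submodular; the polymatroid is $P_f=\{\mathbf x\in\mathbb R_+^N:\sum_{n\in S}x_n\le f(S)\ \forall S\subseteq\mathcal N\}$. The minimum distance is $\triangle f=\min_{S\subseteq\mathcal N}\min_{i\ne j\in\mathcal N\setminus S}|f(S\cup\{i\})+f(S\cup\{j\})-f(S)-f(S\cup\{i,j\})|$. $P_{\tilde f}=\{\mathbf y\in\mathbb N^N:\sum_{n\in S}y_n\le\tilde f(S)\ \forall S\subseteq\mathcal N\}$. $[z]^+=\max\{z,0\}$. In the quantized VCG mechanism the resource is split into $M$ equal divisions and (under truthful reporting, which is a dominant strategy) the allocation of divisions maximizes $\sum_n u_n(y_n/M)$ over $\mathbf y\in P_{\tilde f}$; its efficiency is the ratio of the resulting social welfare to the optimal social welfare without quantization. *)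

(* Defs.v *)
From mathcomp Require Export all_boot all_order all_algebra.
From mathcomp Require Export all_classical all_reals all_analysis.
Export Order.TTheory GRing.Theory Num.Theory.
Export numFieldNormedType.Exports.

Set Implicit Arguments.
Unset Strict Implicit.
Unset Printing Implicit Defensive.

Local Open Scope classical_set_scope.
Local Open Scope ring_scope.

Definition rank_function (R : realType) (N : nat) (f : {set 'I_N} -> R) : Prop :=
  [/\ f finset.set0 = 0,
      forall S T : {set 'I_N}, S \subset T -> f S <= f T &
      forall S T : {set 'I_N}, f (S :|: T) + f (S :&: T) <= f S + f T].

Definition polymatroid (R : realType) (N : nat) (f : {set 'I_N} -> R) :
    set 'rV[R]_N :=
  [set x : 'rV[R]_N | (forall n, 0 <= x 0 n) /\
           (forall S : {set 'I_N}, \sum_(n in S) x 0 n <= f S)].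

Definition integral_polymatroid (N : nat) (g : {set 'I_N} -> int) :
    set 'rV[nat]_N :=
  [set y : 'rV[nat]_N | forall S : {set 'I_N}, \sum_(n in S) (y 0 n)%:Z <= g S].

(* The set of gaps is finite, and nonempty as soon as 2 <= N, so the infimum is
   the minimum. A set S with fewer than two elements outside it contributes no
   gap. *)
Definition min_distance (R : realType) (N : nat) (f : {set 'I_N} -> R) : R :=
  inf [set d | exists (S : {set 'I_N}) (i j : 'I_N),
         [/\ i \notin S, j \notin S, i != j &
             d = `|f (i |: S) + f (j |: S) - f S - f (i |: (j |: S))|]].

Definition quantized_rank (R : realType) (N : nat) (f : {set 'I_N} -> R)
    (M : nat) (S : {set 'I_N}) : int :=
  Num.floor (f S * M%:R).

(* Utilities are functions on [0,1]; values of u outside [0,1] are irrelevant.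
   The derivative is only required in the open interval, together with
   continuity up to the endpoints, which differentiability on the closed
   interval (with one-sided derivatives at 0 and 1) implies. *)
Definition utility (R : realType) (alpha beta : R) (u : R -> R) : Prop :=
  [/\ {in `[0, 1], forall x, 0 <= u x},
      convex_function (E := R^o) `[0, 1] (fun x => - u x),
      {in `[0, 1] &, {homo u : x y / x < y}},
      derivable_oo_LRcontinuous u 0 1 &
      {in `]0, 1[, forall x, beta < (u^`())%classic x < alpha}].

Definition welfare (R : realType) (N : nat) (u : 'I_N -> R -> R)
    (x : 'rV[R]_N) : R :=
  \sum_(n < N) u n (x 0 n).

(* The shares of the resource when agent n receives y_n of M equal divisions. *)
Definition shares (R : realType) (N M : nat) (y : 'rV[nat]_N) : 'rV[R]_N :=
  \row_n ((y 0 n)%:R / M%:R).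

Definition is_max (R : realType) (A : set R) (m : R) : Prop :=
  A m /\ ubound A m.

(* Main.v *)
(** Write [phi n t = u n t - beta * t]: this is nonnegative, nondecreasing, concave
    and [(alpha - beta)]-Lipschitz on [[0, 1]], and on vectors using the whole
    resource the welfare is [sum_n phi n + beta].  The gap hypothesis
    [min_distance f >= 2 / M] absorbs the two roundings in the submodular
    inequality, so the floor of [M f] is still submodular and every integral
    point extends to one of total [M].  Extending the integer part of an optimal
    [M x] gives a [y] that falls short of [M x] by less than one division, and
    for fewer than [N] agents, so the loss [D] satisfies
    [D <= (N - 1) (alpha - beta) / M].  Let [Q = Wq - beta].  For [N >= 3] the
    missing increments are dominated by the allocation [(1, ..., 1)], so
    [D <= Q]; for [N = 2] the only missing increment follows at least one
    division already given, and concavity yields [2 D <= Q].  In both cases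
    [2 D <= (N - 1) Q], and the two bounds on [D] combine to the claim. *)

Require Import Defs.
From mathcomp Require Import finset ring lra zify.

Set Implicit Arguments.
Unset Strict Implicit.
Unset Printing Implicit Defensive.

Local Open Scope classical_set_scope.
Local Open Scope ring_scope.

(** * Tight sets and bases of integral polymatroids *)

Definition submodular (R : numDomainType) (N : nat) (g : {set 'I_N} -> R) : Prop :=
  forall S T : {set 'I_N}, g (S :|: T) + g (S :&: T) <= g S + g T.

Lemma sum_setUI (V : nmodType) (N : nat) (S T : {set 'I_N}) (a : 'I_N -> V) :
  \sum_(n in S :|: T) a n + \sum_(n in S :&: T) a n
  = \sum_(n in S) a n + \sum_(n in T) a n.
Proof.
rewrite !(big_mkcond (fun n => n \in _)) -!big_split; apply: eq_bigr => n _.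
by rewrite !inE /=; case: (n \in S); case: (n \in T); rewrite /= ?addr0 ?add0r.
Qed.

Definition tight (N : nat) (g : {set 'I_N} -> int) (y : 'rV[nat]_N)
    (S : {set 'I_N}) : Prop :=
  \sum_(n in S) (y 0 n)%:Z = g S.

Definition scaled_rank (R : realType) (N : nat) (f : {set 'I_N} -> R) (M : nat)
    (S : {set 'I_N}) : R :=
  f S * M%:R.

Section IntegralPolymatroid.
Variables (N : nat) (g : {set 'I_N} -> int).
Hypothesis g_sub : submodular g.

Local Notation tight := (tight g).

(** Uncrossing: the sums over union and intersection add up to [g S + g T], each is at most the
    value of [g], and submodularity leaves no slack for either. *)
Lemma tight_setU (y : 'rV[nat]_N) (S T : {set 'I_N}) :
  integral_polymatroid g y -> tight y S -> tight y T -> tight y (S :|: T).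
Proof.
rewrite /tight => yP yS yT; have := sum_setUI S T (fun n => (y 0 n)%:Z).
have := yP (S :|: T); have := yP (S :&: T); have := g_sub S T.
by rewrite yS yT => *; lra.
Qed.

(** The union of the given tight sets is formed one agent at a time, starting from the empty set,
    which is tight because [g set0 = 0]. *)
Lemma tight_cover (y : 'rV[nat]_N) :
  integral_polymatroid g y -> g set0 = 0 ->
  (forall n, exists2 T : {set 'I_N}, n \in T & tight y T) ->
  tight y [set: 'I_N]%SET.
Proof.
move=> yP g0 cov.
suff /(_ N)[S sub tS] : forall k, exists2 S : {set 'I_N},
    (forall n : 'I_N, (n < k)%N -> n \in S) & tight y S.
  suff -> : [set: 'I_N]%SET = S by [].
  by apply/esym/setP => n; rewrite sub// inE.
elim=> [|k [S subS tS]]; first by exists set0 => //; rewrite /tight big_set0.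
have [kN|Nk] := ltnP k N; last first.
  exists S => // n _; apply: subS; exact: leq_trans (ltn_ord n) Nk.
have [T kT tT] := cov (Ordinal kN).
exists (S :|: T); last exact: tight_setU.
move=> n; rewrite ltnS leq_eqVlt inE => /orP[/eqP nk|/subS ->//].
by rewrite (_ : n = Ordinal kN) ?kT ?orbT//; exact: val_inj.
Qed.

(** Greedy augmentation: while the total is below [g] of the full set, [tight_cover] yields an agent
    lying in no tight set, and that agent can receive one more unit. The induction is on the
    remaining deficit [d]. *)
Lemma extend_to_base (z : 'rV[nat]_N) :
  integral_polymatroid g z -> g set0 = 0 ->
  exists y : 'rV[nat]_N, [/\ integral_polymatroid g y,
    forall n : 'I_N, (z 0%R n <= y 0%R n)%N & \sum_n (y 0 n)%:Z = g [set: 'I_N]%SET].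
Proof.
move=> zP g0; pose d (y : 'rV[nat]_N) := absz (g [set: 'I_N]%SET - \sum_n (y 0 n)%:Z)%R.
have [k] := ubnP (d z).
elim: k => // k IH in z zP *; rewrite ltnS => zk.
have sumT (y : 'rV[nat]_N) :
    \sum_(n in [set: 'I_N]%SET) (y 0 n)%:Z = \sum_n (y 0 n)%:Z.
  by apply: eq_bigl => n; rewrite inE.
have := zP [set: 'I_N]%SET; rewrite sumT => zle.
have [zE|zN] := eqVneq (\sum_n (z 0 n)%:Z) (g [set: 'I_N]%SET); first by exists z.
have [n nfree] : exists n, forall T : {set 'I_N}, n \in T -> ~ tight z T.
  apply: contrapT => nex; move/eqP: zN; apply; rewrite -sumT.
  apply: tight_cover => // n; apply: contrapT => nT; apply: nex; exists n => T nin tT.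
  by apply: nT; exists T.
pose z' : 'rV[nat]_N := \row_m (z 0%R m + (m == n))%N.
have z'E m : (z' 0 m)%:Z = (z 0 m)%:Z + (m == n)%:Z by rewrite !mxE PoszD.
have sumz' (S : {set 'I_N}) :
    \sum_(m in S) (z' 0 m)%:Z = \sum_(m in S) (z 0 m)%:Z + (n \in S)%:Z.
  rewrite (eq_bigr _ (fun m _ => z'E m)) big_split/=; congr (_ + _).
  case: (boolP (n \in S)) => nS.
    rewrite (bigD1 n)//= eqxx big1 ?addr0// => m /andP[_ /negbTE ->//].
  by apply: big1 => m mS; case: eqP mS nS => // -> ->.
have z'P : integral_polymatroid g z'.
  (* A set containing [n] is not tight, and integrality turns this into a slack of at least one. *)
  move=> S; rewrite sumz'; have := zP S; have := nfree S; rewrite /tight.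
  by case: (n \in S) => /= [/(_ isT)|_]; lia.
have := sumz' [set: 'I_N]%SET; rewrite !sumT inE /= => sz'.
have [|y [yP yz ys]] := IH z' z'P; first
  by move: zle zN zk; rewrite /d sz'; move: (\sum_n _) (g _) => a b; lia.
exists y; split => // m; apply: leq_trans (yz m); have := z'E m; lia.
Qed.

End IntegralPolymatroid.

(** * The scaled rank function, its floor, and lower bounds on both *)

Section QuantizedRank.
Variables (R : realType) (N M : nat) (f : {set 'I_N} -> R).
Hypotheses (hN : (2 <= N)%N) (hf : rank_function f)
  (hf1 : f [set: 'I_N]%SET = 1) (hD : 0 < min_distance f)
  (hM : 2 / min_distance f <= M%:R).

Local Notation F := (scaled_rank f M).
Local Notation g := (quantized_rank f M).

(** Submodularity makes the gap nonnegative, which removes the absolute value in [min_distance];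
    scaling by [M] then brings the gap to at least 2. *)
Lemma gap_ge2 (S : {set 'I_N}) (i j : 'I_N) :
  i \notin S -> j \notin S -> i != j ->
  2 <= F (i |: S) + F (j |: S) - F S - F (i |: (j |: S)).
Proof.
move=> iS jS ij; have [f0 fmono fsub] := hf.
have := fsub (i |: S) (j |: S).
have -> : (i |: S) :|: (j |: S) = i |: (j |: S).
  by apply/setP => n; rewrite !inE; case: (n == i); case: (n == j); case: (n \in S).
have -> : (i |: S) :&: (j |: S) = S.
  apply/setP => n; rewrite !inE; case: (eqVneq n i) => [->|_]; last first.
    by case: (n == j) => //=; case: (n \in S).
  by rewrite (negbTE ij) (negbTE iS).
move=> sub.
have : min_distance f <= `|f (i |: S) + f (j |: S) - f S - f (i |: (j |: S))|.
  apply: ge_inf; last by exists S, i, j.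
  by exists 0 => _ [S' [i' [j' [_ _ _ ->]]]].
rewrite ger0_norm; last lra.
move=> Dle; move: hM; rewrite ler_pdivrMr// => hM'.
have M0 : 0 <= M%:R :> R by [].
have := ler_wpM2l M0 Dle; rewrite /scaled_rank; lra.
Qed.

Lemma scaled_rank_mono (S T : {set 'I_N}) : S \subset T -> F S <= F T.
Proof. by move=> ST; case: hf => _ fm _; rewrite ler_wpM2r// fm. Qed.

Lemma scaled_rank_submodular : submodular F.
Proof.
move=> S T; case: hf => _ _ fs; have M0 : 0 <= M%:R :> R by [].
have := ler_wpM2r M0 (fs S T); rewrite /scaled_rank; lra.
Qed.

(** Take [i] in [S] outside [T] and [j] in [T] outside [S]. The gap of 2 at the base set [S :\ i] is
    carried to [S] and [T] by two further submodular inequalities, [h1] and [h2]. *)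
Lemma scaled_rank_submodular_gap (S T : {set 'I_N}) :
  ~~ (S \subset T) -> ~~ (T \subset S) ->
  F (S :|: T) + F (S :&: T) + 2 <= F S + F T.
Proof.
move=> /subsetPn[i iS iT] /subsetPn[j jT jS].
have ij : i != j by apply: contraNneq jS => <-.
have iSi : i \notin S :\ i by rewrite !inE eqxx.
have jSi : j \notin S :\ i by rewrite !inE (negbTE jS) andbF.
have := gap_ge2 iSi jSi ij.
have h1 := scaled_rank_submodular (j |: S) ((S :\ i) :|: T).
have h2 := scaled_rank_submodular (S :\ i) T.
have e1 : (j |: S) :|: ((S :\ i) :|: T) = S :|: T.
  apply/setP => n; rewrite !inE; case: (eqVneq n j) => [->|_]; first by rewrite jT !orbT.
  by case: (n \in S); case: (n \in T); rewrite ?orbT ?orbF ?andbF.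
have e2 : (j |: S) :&: ((S :\ i) :|: T) = (j |: (S :\ i)) :|: (S :&: T).
  apply/setP => n; rewrite !inE; case: (eqVneq n j) => [->|_].
    by rewrite jT (negbTE jS) !orbT.
  by case: (eqVneq n i) => [->|_] /=; rewrite ?(negbTE iT); case: (n \in S); case: (n \in T).
have e3 : (S :\ i) :&: T = S :&: T.
  apply/setP => n; rewrite !inE; case: (eqVneq n i) => [->|_] //.
  by rewrite (negbTE iT) !andbF.
rewrite setD1K// (_ : i |: (j |: (S :\ i)) = j |: S); last first.
  by rewrite setUCA setD1K.
move: h1; rewrite e1 e2 => h1; move: h2; rewrite e3 => h2.
have := scaled_rank_mono (subsetUl (j |: (S :\ i)) (S :&: T)).
lra.
Qed.

(** Comparable sets give an equality. Otherwise the floors of [F S] and [F T] lose less than 1 each,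
    within the available gap of 2. *)
Lemma quantized_rank_submodular : submodular g.
Proof.
move=> S T; have [ST|nST] := boolP (S \subset T).
  by rewrite (setUidPr ST) (setIidPl ST) addrC.
have [TS|nTS] := boolP (T \subset S).
  by rewrite (setUidPl TS) (setIidPr TS).
have := scaled_rank_submodular_gap nST nTS.
rewrite /quantized_rank -/(F S) -/(F T) -/(F (S :|: T)) -/(F (S :&: T)) => gap.
rewrite -(ler_int R) !rmorphD /=.
have := floor_le (F (S :|: T)); have := floor_le (F (S :&: T)).
have := floorD1_gt (F S); have := floorD1_gt (F T).
rewrite !rmorphD /=; lra.
Qed.

Lemma quantized_rank0 : g set0 = 0.
Proof. by rewrite /quantized_rank; case: hf => -> _ _; rewrite mul0r floor0. Qed.

Lemma quantized_rankT : g [set: 'I_N]%SET = M.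
Proof. by rewrite /quantized_rank hf1 mul1r (intrKfloor (M%:Z)). Qed.

Lemma le_quantized_rank (S : {set 'I_N}) (m : int) : (m <= g S) = (m%:~R <= F S).
Proof. exact: floor_ge_int. Qed.

(** The second outsider [j] is what makes the gap available; monotonicity then discards the two
    terms that contain [j]. *)
Lemma marginal_ge2 (S : {set 'I_N}) (i j : 'I_N) :
  i \notin S -> j \notin S -> i != j -> F S + 2 <= F (i |: S).
Proof.
move=> iS jS ij; have := gap_ge2 iS jS ij.
have : F (j |: S) <= F (i |: (j |: S)) by apply: scaled_rank_mono; exact: subsetUr.
lra.
Qed.

(** Elements are removed one at a time, each worth at least 2. An agent [j] outside [S] serves in
    [marginal_ge2], so the full set is excluded. *)
Lemma scaled_rank_ge_card2 (S : {set 'I_N}) : S != [set: 'I_N]%SET -> 2 * #|S|%:R <= F S.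
Proof.
have [k] := ubnP #|S|; elim: k => // k IH in S *; rewrite ltnS => Sk ST.
have [->|/set0Pn[i iS]] := eqVneq S set0.
  by rewrite /scaled_rank; case: hf => -> _ _; rewrite cards0 mul0r mulr0.
have [j jS] : exists j, j \notin S.
  apply: contrapT => nj; move/eqP: ST; apply; apply/setP => j; rewrite inE.
  by apply: contrapT => /negP jS; apply: nj; exists j.
have iSi : i \notin S :\ i by rewrite !inE eqxx.
have jSi : j \notin S :\ i by rewrite !inE (negbTE jS) andbF.
have ij : i != j by apply: contraNneq jS => <-.
have := marginal_ge2 iSi jSi ij; rewrite setD1K// => le2.
have cS := cardsD1 i S; rewrite iS in cS.
have Di : S :\ i != [set: 'I_N]%SET by apply: contraNneq iSi => ->; rewrite inE.
have /IH/(_ Di) : (#|S :\ i| < k)%N by move: Sk; rewrite cS.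
by rewrite cS natrD /=; lra.
Qed.

(** For the full set, drop one agent: [2 * (N - 1)] is at least [N] since [N] is at least 2. This
    makes the all-ones allocation feasible and gives [leN_M]. *)
Lemma scaled_rank_ge_card (S : {set 'I_N}) : #|S|%:R <= F S.
Proof.
have [->|/scaled_rank_ge_card2 le2] := eqVneq S [set: 'I_N]%SET; last first.
  by apply: le_trans le2; rewrite ler_peMl// ler1n.
have N0 : (0 < N)%N by apply: leq_trans hN.
pose i := Ordinal N0; have iT : i \in [set: 'I_N]%SET by rewrite inE.
have := @scaled_rank_ge_card2 ([set: 'I_N]%SET :\ i).
have -> : [set: 'I_N]%SET :\ i != [set: 'I_N]%SET.
  by apply: contraTneq iT => <-; rewrite !inE eqxx.
move=> /(_ isT); have := cardsD1 i [set: 'I_N]%SET; rewrite iT cardsT card_ord add1n.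
move=> NE; have /scaled_rank_mono : [set: 'I_N]%SET :\ i \subset [set: 'I_N]%SET by exact: subsetT.
have c1 : (1 <= #|[set: 'I_N]%SET :\ i|)%N by move: hN; rewrite {1}NE.
have : 1 <= #|[set: 'I_N]%SET :\ i|%:R :> R by rewrite ler1n.
rewrite [X in X%:R <= F _]NE -natr1; lra.
Qed.

Lemma leN_M : (N <= M)%N.
Proof.
have := scaled_rank_ge_card [set: 'I_N]%SET.
by rewrite cardsT card_ord /scaled_rank hf1 mul1r ler_nat.
Qed.

Lemma scaled_rank_single_ge2 (n : 'I_N) : 2 <= F [set n]%SET.
Proof.
have : [set n]%SET != [set: 'I_N]%SET.
  apply/eqP => /(congr1 (fun S : {set 'I_N} => #|S|)); rewrite cards1 cardsT card_ord.
  by move=> N1; move: hN; rewrite -N1.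
by move/scaled_rank_ge_card2; rewrite cards1 mulr1.
Qed.

End QuantizedRank.

(** * Slopes and increments of a utility function *)

Section Utility.
Variables (R : realType) (alpha beta : R) (u : R -> R).
Hypothesis hu : utility alpha beta u.

(** Mean value theorem on the open interval, with continuity covering the endpoints 0 and 1. *)
Lemma utility_slope (a b : R) : 0 <= a -> a <= b -> b <= 1 ->
  beta * (b - a) <= u b - u a <= alpha * (b - a).
Proof.
move=> a0; rewrite le_eqVlt => /predU1P[->|ab] b1.
  by rewrite !subrr !mulr0 lexx.
have [_ _ _ ud u'] := hu; have [der _ _] := ud.
have sub t : t \in `]a, b[ -> t \in `]0, 1[.
  by rewrite !in_itv/= => /andP[h1 h2]; apply/andP; split; lra.
have [||c /sub /u' /andP[h1 h2] ->] := @MVT R u (u^`())%classic a b ab.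
- by move=> t /sub /der ht; rewrite derive1E; exact: derivableP.
- apply: continuous_subspaceW (derivable_oo_LRcontinuous_within ud) => t /=.
  by rewrite !in_itv/= => /andP[h1 h2]; apply/andP; split; lra.
have ba : 0 < b - a by lra.
by rewrite !ler_pM2r// !ltW.
Qed.

(** Both [a + h] and [b] are convex combinations of [a] and [b + h], with the weights [l] and
    [1 - l] exchanged; adding the two concavity inequalities cancels the weights. *)
Lemma utility_increment_nonincreasing (a b h : R) :
  0 <= a -> a <= b -> 0 <= h -> b + h <= 1 ->
  u (b + h) - u b <= u (a + h) - u a.
Proof.
move=> a0; rewrite le_eqVlt => /predU1P[<- _ _|ab h0 bh1]; first exact: lexx.
have [_ cvx _ _ _] := hu.
have d0 : 0 < b + h - a by lra.
have l0 : 0 <= h / (b + h - a) by apply: divr_ge0 => //; exact: ltW.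
have l1 : h / (b + h - a) <= 1 by rewrite ler_pdivrMr// mul1r; lra.
have aI : a \in `[0, 1]%classic by rewrite mem_setE in_itv/=; apply/andP; split; lra.
have bI : b + h \in `[0, 1]%classic by rewrite mem_setE in_itv/=; apply/andP; split; lra.
set l := h / _ in l0 l1.
have lE : l * (b + h - a) = h by rewrite /l divfK// gt_eqF.
have : - u (l * (b + h) + (1 - l) * a) <= l * - u (b + h) + (1 - l) * - u a.
  exact: cvx (Itv01 l0 l1) (b + h) a bI aI.
have : - u (l * a + (1 - l) * (b + h)) <= l * - u a + (1 - l) * - u (b + h).
  exact: cvx (Itv01 l0 l1) a (b + h) aI bI.
have -> : l * (b + h) + (1 - l) * a = a + l * (b + h - a) by ring.
have -> : l * a + (1 - l) * (b + h) = b + h - l * (b + h - a) by ring.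
rewrite lE addrK; lra.
Qed.

End Utility.

(** * Compactness of the polymatroid and existence of the unquantized optimum *)

Lemma polymatroid_itv (R : realType) (N : nat) (f : {set 'I_N} -> R) (x : 'rV[R]_N)
    (n : 'I_N) :
  rank_function f -> f [set: 'I_N]%SET = 1 -> polymatroid f x -> 0 <= x 0 n <= 1.
Proof.
move=> [_ fm _] f1 [x0 xf]; rewrite x0/=.
have := xf [set n]%SET; rewrite big_set1 => /le_trans; apply.
by rewrite -f1; apply: fm; exact: subsetT.
Qed.

(** A closed subset of the unit cube, being an intersection of preimages of closed half-lines under
    continuous linear forms. *)
Lemma polymatroid_compact (R : realType) (N : nat) (f : {set 'I_N} -> R) :
  rank_function f -> f [set: 'I_N]%SET = 1 -> compact (polymatroid f).
Proof.
move=> hf f1.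
have cK : compact [set x : 'rV[R]_N | forall n, `[0, 1]%classic (x ord0 n)].
  by apply: (@rV_compact R N (fun=> `[0, 1]%classic)) => _; exact: segment_compact.
apply: subclosed_compact cK _; last first.
  by move=> x xP n /=; rewrite in_itv/=; exact: polymatroid_itv xP.
have -> : polymatroid f =
    (\bigcap_(n in @classical_sets.setT 'I_N) ((fun x : 'rV[R]_N => x 0 n) @^-1` [set t | 0 <= t]))
    `&` (\bigcap_(S in @classical_sets.setT {set 'I_N})
           ((fun x : 'rV[R]_N => \sum_(n in S) x 0 n) @^-1` [set t | t <= f S])).
  apply/seteqP; split => x /=.
    by move=> [x0 xf]; split => [n _|S _]; [exact: x0|exact: xf].
  by move=> [x0 xf]; split => [n|S]; [exact: x0|exact: xf].
apply: closedI.
  apply: closed_bigI => n _; apply: preimage_closed.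
    by move=> x _; exact: coord_continuous.
  exact: closed_ge.
apply: closed_bigI => S _; apply: preimage_closed; last exact: closed_le.
move=> x _; apply: (@continuous_big _ _ +%R 0 (mem S)) => [|n _]; last exact: coord_continuous.
exact: add_continuous.
Qed.

(** Utilities are constrained on [0, 1] only. Clamping the argument gives a function that is
    [alpha]-Lipschitz on the whole line, so the extreme value theorem can be applied without
    subspace topologies. *)
Lemma utility_clamp_continuous (R : realType) (alpha beta : R) (u : R -> R) :
  0 < alpha -> 0 < beta -> utility alpha beta u ->
  continuous (fun t : R => u (Num.max 0 (Num.min 1 t))).
Proof.
move=> a0 b0 hu t; apply/cvgrPdist_le => e e0.
pose c (s : R) := Num.max 0 (Num.min 1 s).
have lip s r : s <= r -> `|u (c r) - u (c s)| <= alpha * (r - s).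
  move=> sr.
  have [c0 c1 c2 c3] : [/\ 0 <= c s, c s <= c r, c r <= 1 & c r - c s <= r - s].
    rewrite /c /Order.max /Order.min.
    by case: (ltP 1 s); case: (ltP 1 r); case: (ltP 0 s); case: (ltP 0 r);
      rewrite ?ltr01; split; lra.
  have /andP[h1 h2] := utility_slope hu c0 c1 c2.
  rewrite ger0_norm; first by apply: le_trans h2 _; rewrite ler_pM2l.
  apply: le_trans h1; apply: mulr_ge0; lra.
near=> s; apply: (@le_trans _ _ (alpha * `|t - s|)).
  have [ts|/ltW st] := leP t s.
    by rewrite distrC (le_trans (lip _ _ ts))// ler_pM2l// distrC ler_norm.
  by rewrite (le_trans (lip _ _ st))// ler_pM2l// ler_norm.
rewrite -ler_pdivlMl//; near: s.
have ea : 0 < alpha^-1 * e by rewrite mulr_gt0 ?invr_gt0.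
exact: (cvgr_dist_le _ _ (@cvg_id _ (nbhs t)) _ ea).
Unshelve. all: by end_near.
Qed.

Lemma welfare_max_exists (R : realType) (N : nat) (f : {set 'I_N} -> R)
    (alpha beta : R) (u : 'I_N -> R -> R) :
  rank_function f -> f [set: 'I_N]%SET = 1 -> 0 < alpha -> 0 < beta ->
  (forall n, utility alpha beta (u n)) ->
  exists W, is_max [set welfare u x | x in polymatroid f] W.
Proof.
move=> hf f1 a0 b0 hu.
pose c (s : R) := Num.max 0 (Num.min 1 s).
pose w (x : 'rV[R]_N) := welfare (fun n t => u n (c t)) x.
have wE x : polymatroid f x -> w x = welfare u x.
  move=> xP; apply: eq_bigr => n _; congr (u n _).
  have /andP[x0 x1] := polymatroid_itv n hf f1 xP.
  by rewrite /c min_r// max_r.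
have P0 : polymatroid f !=set0.
  exists 0; split => [n|S]; first by rewrite mxE.
  rewrite big1 => [|n _]; last by rewrite mxE.
  by case: hf => <- fm _; apply: fm; exact: sub0set.
have [||x xP xmax] := compact_EVT_max (f := w) P0; first exact: polymatroid_compact.
  apply: continuous_subspaceT; apply: continuous_big => [|n _ x]; first exact: add_continuous.
  apply: (@continuous_comp _ _ _ (fun x : 'rV[R]_N => x 0 n) (fun t : R => u n (c t))).
    exact: coord_continuous.
  exact: (utility_clamp_continuous a0 b0 (hu n)).
move/set_mem: xP => xP; exists (welfare u x); split; first by exists x.
by move=> _ [y yP <-]; rewrite -!wE//; apply: xmax; exact: mem_set.
Qed.

(** * The welfare lost by rounding an allocation to whole divisions *)

Section Rounding.
Variables (R : realType) (N M : nat) (f : {set 'I_N} -> R).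
Hypotheses (hN : (2 <= N)%N) (hf : rank_function f)
  (hf1 : f [set: 'I_N]%SET = 1) (hD : 0 < min_distance f)
  (hM : 2 / min_distance f <= M%:R).

Local Notation F := (scaled_rank f M).
Local Notation g := (quantized_rank f M).

Lemma quantized_rank_mono (S T : {set 'I_N}) : S \subset T -> g S <= g T.
Proof. by move=> ST; apply: le_floor; exact: scaled_rank_mono. Qed.

Lemma quantized_rank_ge0 (S : {set 'I_N}) : 0 <= g S.
Proof. by rewrite -(quantized_rank0 M hf) quantized_rank_mono// sub0set. Qed.

Lemma M_gt0 : (0 < M)%N.
Proof. by apply: leq_trans (leN_M hN hf hf1 hD hM); apply: ltnW. Qed.

Let M0 : 0 < M%:R :> R.
Proof. by rewrite ltr0n M_gt0. Qed.

Lemma integral_polymatroid_le (y : 'rV[nat]_N) (n : 'I_N) :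
  integral_polymatroid g y -> (y 0%R n <= M)%N.
Proof.
move=> yP; rewrite -lez_nat -(quantized_rankT M hf1).
have := yP [set n]%SET; rewrite big_set1 => /le_trans; apply.
exact/quantized_rank_mono/subsetT.
Qed.

Lemma base_exists (z : 'rV[nat]_N) : integral_polymatroid g z ->
  exists y : 'rV[nat]_N, [/\ integral_polymatroid g y,
    forall n : 'I_N, (z 0%R n <= y 0%R n)%N & \sum_n (y 0 n)%:R = M%:R :> R].
Proof.
move=> zP; have [|y [yP zy ys]] := extend_to_base _ zP (quantized_rank0 M hf).
  exact: quantized_rank_submodular.
exists y; split => //; rewrite (quantized_rankT M hf1) in ys.
by have /(congr1 (fun k : int => k%:~R : R)) := ys; rewrite rmorph_sum.
Qed.

Lemma truncn_polymatroid (x : 'rV[R]_N) : polymatroid f x ->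
  integral_polymatroid g (\row_n Num.truncn (x 0 n * M%:R)).
Proof.
move=> [x0 xf] S; rewrite (le_quantized_rank M f) rmorph_sum /=.
apply: (@le_trans _ _ (\sum_(n in S) x 0 n * M%:R)).
  by apply: ler_sum => n _; rewrite mxE truncn_le mulr_ge0// ltW.
by rewrite -mulr_suml ler_pM2r.
Qed.

Lemma single_polymatroid (n : 'I_N) (k : nat) : k%:Z <= g [set n]%SET ->
  integral_polymatroid g (\row_m (if m == n then k else 0%N)).
Proof.
move=> kg S; have [nS|nS] := boolP (n \in S).
  rewrite (bigD1 n)//= big1 => [|m /andP[_ /negbTE mn]]; last by rewrite mxE mn.
  rewrite mxE eqxx addr0; apply: le_trans kg _; apply: quantized_rank_mono.
  by rewrite sub1set.
rewrite big1 ?quantized_rank_ge0// => m mS; rewrite mxE; case: eqP => // mn.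
by move: nS; rewrite -mn mS.
Qed.

(** These are later instantiated with [u n t - beta * t], [alpha - beta] and [Wq - beta]. The bound
    [Q_ub] ranges over all feasible integral points, including those of total below [M]. *)
Variables (phi : 'I_N -> R -> R) (c Q : R).
Hypotheses
  (phi0 : forall n (t : R), 0 <= t -> t <= 1 -> 0 <= phi n t)
  (phi_mono : forall n (s t : R), 0 <= s -> s <= t -> t <= 1 -> phi n s <= phi n t)
  (phi_lip : forall n (s t : R), 0 <= s -> s <= t -> t <= 1 ->
     phi n t - phi n s <= c * (t - s))
  (phi_conc : forall n (s t h : R), 0 <= s -> s <= t -> 0 <= h -> t + h <= 1 ->
     phi n (t + h) - phi n t <= phi n (s + h) - phi n s)
  (Q_ub : forall y, integral_polymatroid g y ->
     \sum_n phi n ((y 0 n)%:R / M%:R) <= Q).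

Local Notation psi n k := (phi n (k%:R / M%:R)).

Let itvM (k : nat) : (k <= M)%N -> 0 <= (k%:R / M%:R : R) <= 1.
Proof. by move=> kM; rewrite divr_ge0//= ler_pdivrMr// mul1r ler_nat. Qed.

Lemma psi_ge0 n (k : nat) : (k <= M)%N -> 0 <= psi n k.
Proof. by move=> /itvM/andP[k0 k1]; exact: phi0. Qed.

Lemma psi_increment_nonincreasing n (j k : nat) : (j <= k)%N -> (k < M)%N ->
  psi n k.+1 - psi n k <= psi n j.+1 - psi n j.
Proof.
move=> jk kM; have h m : m.+1%:R / M%:R = m%:R / M%:R + M%:R^-1 :> R.
  by rewrite -natr1 mulrDl mul1r.
have /andP[_] := itvM kM; rewrite !h => k1; apply: phi_conc => //.
by rewrite ler_pM2r ?invr_gt0// ler_nat.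
Qed.

Lemma single_le_Q n (k : nat) : k%:Z <= g [set n]%SET -> psi n k <= Q.
Proof.
move=> kg; apply: le_trans (Q_ub (single_polymatroid kg)).
rewrite (bigD1 n)//= mxE eqxx lerDl sumr_ge0// => m /negbTE mn.
by rewrite mxE mn psi_ge0.
Qed.

Lemma Q_ge0 : 0 <= Q.
Proof.
have i0 : 'I_N by exists 0%N; apply: leq_trans hN.
apply: le_trans (single_le_Q (n := i0) (k := 0) _); first exact: psi_ge0.
exact: quantized_rank_ge0.
Qed.

(** By concavity the increment is at most its predecessor. Two consecutive increments whose upper
    end is feasible for [n] alone sum to at most [Q]. *)
Lemma increment_le_half n (k : nat) :
  (0 < k)%N -> (k < M)%N -> k%:Z <= g [set n]%SET ->
  2 * (psi n k.+1 - psi n k) <= Q.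
Proof.
case: k => // k _ kM kg.
have d1 := psi_increment_nonincreasing n (leqnSn k) kM.
have [kg'|kg'] := lerP k.+2%:Z (g [set n]%SET).
  have := single_le_Q kg'; have := psi_ge0 n (ltnW (ltnW kM)); lra.
(* Here [g [set n]] equals [k.+1]; being at least 2, it leaves room for two increments below it,
   both dominating the one beyond it. *)
have : 2%:Z <= g [set n]%SET by rewrite (le_quantized_rank M f); apply: scaled_rank_single_ge2.
case: k => [|k] in kM kg d1 kg' *; first by lia.
move=> _; have d2 := psi_increment_nonincreasing n (leqnSn k) (ltnW kM).
have := single_le_Q kg; have := psi_ge0 n (ltnW (ltnW (ltnW kM))); lra.
Qed.

(** [A] collects the agents for whom [y] falls short of [M x]. Outside [A] monotonicity suffices;
    inside, [x] is at most one division above [y]. [A] omits someone, since otherwise [M x] would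
    have total above [M]. *)
Lemma rounding_loss (x : 'rV[R]_N) (y : 'rV[nat]_N) :
  polymatroid f x -> integral_polymatroid g y ->
  \sum_n (y 0 n)%:R = M%:R :> R ->
  (forall n, x 0 n * M%:R <= (y 0 n).+1%:R) ->
  exists A : {set 'I_N}, [/\ (#|A| < N)%N,
    forall n, n \in A -> (y 0 n)%:R < x 0 n * M%:R,
    forall n, n \in A -> (y 0%R n < M)%N &
    \sum_n phi n (x 0 n) - Q <= \sum_(n in A) (psi n (y 0 n).+1 - psi n (y 0 n))].
Proof.
move=> xP yP ys xy; pose A := [set n | (y 0 n)%:R < x 0 n * M%:R]%SET.
have [x0 xf] := xP.
have yM n : n \in A -> (y 0%R n < M)%N.
  rewrite inE -(ltr_nat R) => yx; apply: lt_le_trans yx _.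
  have /andP[_ x1] := polymatroid_itv n hf hf1 xP.
  by rewrite -[leRHS]mul1r ler_pM2r.
exists A; split => [|n||] //; last 1 first.
- apply: (@le_trans _ _ (\sum_n phi n (x 0 n) - \sum_n psi n (y 0 n))).
    by rewrite lerD2l lerN2 Q_ub.
  rewrite -sumrB [leRHS]big_mkcond; apply: ler_sum => n _.
  have /andP[xn0 xn1] := polymatroid_itv n hf hf1 xP.
  have /andP[yn0 yn1] := itvM (integral_polymatroid_le n yP).
  case: ifPn => [nA|]; last first.
    rewrite inE -leNgt => xy'.
    by rewrite subr_le0; apply: phi_mono => //; rewrite ler_pdivlMr.
  rewrite lerD2r; apply: phi_mono => //; first by rewrite ler_pdivlMr.
  by rewrite ler_pdivrMr// mul1r ler_nat yM.
- rewrite -[X in (_ < X)%N]card_ord -cardsT; apply: proper_card.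
  rewrite properEneq subsetT andbT; apply/eqP => AT.
  have : \sum_n (y 0 n)%:R < \sum_n x 0 n * M%:R :> R.
    apply: ltr_sum; last by move=> n _; have := in_setT n; rewrite -AT inE.
    by apply/hasP; exists (Ordinal (leq_trans (ltnW (ltnSn 1)) hN)); rewrite // mem_index_enum.
  rewrite ys -mulr_suml -ltr_pdivrMr// divff ?gt_eqF// ltNge.
  have := xf [set: 'I_N]%SET; rewrite hf1 (eq_bigl predT) ?negK => [->//|n].
  by rewrite inE.
- by rewrite inE.
Qed.

(** At most [N - 1] increments are missing, each over a length [1 / M] and hence worth at most
    [c / M]. *)
Lemma loss_le_lipschitz (x : 'rV[R]_N) : 0 <= c -> polymatroid f x ->
  \sum_n phi n (x 0 n) - Q <= (N%:R - 1) * c / M%:R.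
Proof.
move=> c0 xP; have [y [yP zy ys]] := base_exists (truncn_polymatroid xP).
have [|A [AN _ yM /le_trans]] := rounding_loss xP yP ys.
  move=> n; apply/ltW/(lt_le_trans (truncnS_gt _)).
  by rewrite ler_nat ltnS; have := zy n; rewrite mxE.
apply; apply: (@le_trans _ _ (\sum_(n in A) c / M%:R)).
  apply: ler_sum => n /yM yMn.
  have /andP[y0 _] := itvM (ltnW yMn); have /andP[_ y1] := itvM yMn.
  apply: le_trans (phi_lip _ y0 _ y1) _.
    by rewrite ler_pM2r ?invr_gt0// ler_nat.
  by rewrite -mulrBl -natrB// subSnn mul1r.
rewrite sumr_const -[leLHS]mulr_natl mulrA ler_pM2r ?invr_gt0// ler_wpM2r//.
by rewrite lerBrDr natr1 ler_nat.
Qed.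

Lemma ones_polymatroid : integral_polymatroid g (\row_n 1%N).
Proof.
move=> S; rewrite (eq_bigr (fun=> 1)) => [|n _]; last by rewrite mxE.
by rewrite sumr_const (le_quantized_rank M f) rmorph_nat; exact: scaled_rank_ge_card.
Qed.

(** By concavity each missing increment is at most the agent's first one, and the first increments
    together are bounded by the value of the all-ones allocation. *)
Lemma loss_le_Q (x : 'rV[R]_N) : polymatroid f x ->
  \sum_n phi n (x 0 n) - Q <= Q.
Proof.
move=> xP; have [y [yP zy ys]] := base_exists (truncn_polymatroid xP).
have [|A [AN _ yM /le_trans]] := rounding_loss xP yP ys.
  move=> n; apply/ltW/(lt_le_trans (truncnS_gt _)).
  by rewrite ler_nat ltnS; have := zy n; rewrite mxE.
apply; apply: le_trans (Q_ub ones_polymatroid).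
rewrite [leLHS]big_mkcond; apply: ler_sum => n _; rewrite mxE.
case: ifPn => nA; last by apply: psi_ge0; exact: M_gt0.
apply: le_trans (psi_increment_nonincreasing n (leq0n _) (yM n nA)) _.
by rewrite lerBlDr lerDl psi_ge0.
Qed.

(** The rounded point is chosen with at least one division per agent whenever possible, so that
    [increment_le_half] applies to the single missing increment. *)
Lemma loss_le_half_welfare_two (x : 'rV[R]_N) : N = 2%N -> polymatroid f x ->
  2 * (\sum_n phi n (x 0 n) - Q) <= Q.
Proof.
move=> N2 xP; have [x0 xf] := xP.
have sx1 : \sum_n x 0 n <= 1.
  by rewrite -hf1; apply: le_trans (xf _); rewrite [leRHS](eq_bigl predT)// => n; rewrite inE.
pose t n := Num.truncn (x 0 n * M%:R).
have tS n : x 0 n * M%:R <= (t n).+1%:R by exact/ltW/truncnS_gt.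
(* Raising the integer part to at least one division each may leave the
   polymatroid only when one agent holds everything, and then [x] is integral. *)
have [[n xn1]|xlt1] := pselect (exists n, 1 <= x 0 n).
  have [y [yP zy ys]] := base_exists (truncn_polymatroid xP).
  have [|A [AN Ay _]] := rounding_loss xP yP ys.
    by move=> m; apply: le_trans (tS m) _; rewrite ler_nat ltnS; have := zy m; rewrite mxE.
  (* No agent falls short: [n] receives all [M] divisions, and the other agent has share 0 in
     [x]. *)
  rewrite [X in _ <= X]big_pred0 => [|m]; first by have := Q_ge0; lra.
  apply/negbTE/negP => mA; have := Ay m mA; apply/negP; rewrite -leNgt; have [->|mn] := eqVneq m n.
    have /andP[_ xn] := polymatroid_itv n hf hf1 xP.
    apply: (@le_trans _ _ M%:R); first by rewrite -[leRHS]mul1r ler_pM2r.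
    rewrite ler_nat; apply: leq_trans (zy n); rewrite mxE truncn_ge_nat.
      by rewrite -[leLHS]mul1r ler_pM2r.
    by rewrite mulr_ge0// ltW.
  have : x 0 m + x 0 n <= 1.
    apply: le_trans sx1; rewrite (bigD1 m)//= lerD2l (bigD1 n) ?(eq_sym n)//=.
    by rewrite lerDl sumr_ge0.
  move=> xmn; apply: (@le_trans _ _ 0) => //.
  by apply: mulr_le0_ge0; [lra|exact: ltW].
have tM n : (t n < M)%N.
  have xn : x 0 n < 1 by rewrite ltNge; apply/negP => xn; apply: xlt1; exists n.
  rewrite /t truncn_lt_nat; first by rewrite -[ltRHS]mul1r ltr_pM2r.
  by rewrite mulr_ge0// ltW.
have tP (S : {set 'I_N}) : \sum_(n in S) (t n)%:Z <= g S.
  by have := truncn_polymatroid xP S; under eq_bigr do rewrite mxE.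
pose z : 'rV[nat]_N := \row_n maxn (t n) 1.
have zP : integral_polymatroid g z.
  move=> S; under eq_bigr do rewrite mxE.
  have [|S1] := leqP #|S| 1.
    rewrite leq_eqVlt ltnS leqn0 cards_eq0 => /orP[/cards1P[n ->]|/eqP->]; last first.
      by rewrite big_set0 (quantized_rank0 M hf).
    have := tP [set n]%SET; rewrite !big_set1.
    have : 2%:Z <= g [set n]%SET.
      by rewrite (le_quantized_rank M f); apply: scaled_rank_single_ge2.
    by case: (leqP (t n) 1) => *; lia.
  have -> : S = [set: 'I_N]%SET.
    by apply/eqP; rewrite eqEcard subsetT cardsT card_ord [X in (X <= _)%N]N2.
  (* Both entries of [t] are below [M], so raising a 0 to 1 keeps the total within [M]; if both are
     0, [2 <= M] is used. *)
  have := tP [set: 'I_N]%SET; rewrite (quantized_rankT M hf1).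
  have := leN_M hN hf hf1 hD hM; move: t tM {tS tP z}; rewrite N2 => t tM.
  have sum2 (a : 'I_2 -> int) :
      \sum_(n in [set: 'I_2]%SET) a n = a ord0 + a (lift ord0 ord0).
    rewrite (eq_bigl predT) => [|n]; last by rewrite inE.
    by rewrite 2!big_ord_recl big_ord0 addr0.
  rewrite !sum2; move: (tM ord0) (tM (lift ord0 ord0)); lia.
have [y [yP zy ys]] := base_exists zP.
have [|A [AN _ yM loss]] := rounding_loss xP yP ys.
  move=> m; apply: le_trans (tS m) _; rewrite ler_nat ltnS.
  by apply: leq_trans (zy m); rewrite mxE leq_maxl.
apply: (@le_trans _ _ (2 * \sum_(n in A) (psi n (y 0 n).+1 - psi n (y 0 n)))).
  by rewrite ler_pM2l.
have : (#|A| <= 1)%N by move: AN; rewrite [X in (_ < X)%N]N2.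
rewrite leq_eqVlt ltnS leqn0 cards_eq0 => /orP[/cards1P[n AE]|/eqP->]; last first.
  by rewrite big_set0 mulr0 Q_ge0.
rewrite AE big_set1; apply: increment_le_half.
- by apply: leq_trans (zy n); rewrite mxE leq_maxr.
- by apply: yM; rewrite AE inE.
- by have := yP [set n]%SET; rewrite big_set1.
Qed.

Lemma loss_le_welfare (x : 'rV[R]_N) : polymatroid f x ->
  2 * (\sum_n phi n (x 0 n) - Q) <= (N%:R - 1) * Q.
Proof.
move=> xP; have := hN; rewrite leq_eqVlt => /predU1P[N2|N3].
  apply: le_trans (loss_le_half_welfare_two (esym N2) xP) _.
  by rewrite -N2 (_ : 2%:R - 1 = 1) ?mul1r//; ring.
have := loss_le_Q xP; have := Q_ge0.
have : 3%:R <= N%:R :> R by rewrite ler_nat.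
nra.
Qed.

End Rounding.

(** * Existence of the quantized optimum and assembly of the bound *)

Lemma bounded_nat_max_exists (R : realType) (N M : nat) (A : set 'rV[nat]_N)
    (w : 'rV[nat]_N -> R) :
  A !=set0 -> (forall y, A y -> forall n : 'I_N, (y 0%R n <= M)%N) ->
  exists W, is_max [set w y | y in A] W.
Proof.
(* Entries bounded by [M] are coded in ['I_M.+1], which turns the search into a maximum over a
   finite type. *)
move=> [y0 Ay0] AM; pose v (z : 'rV['I_M.+1]_N) : 'rV[nat]_N := \row_n nat_of_ord (z 0 n).
have vK y : A y -> v (\row_n inord (y 0 n)) = y.
  by move=> /AM yM; apply/rowP => n; rewrite !mxE inordK// ltnS yM.
pose P z := `[< A (v z) >].
have P0 : P (\row_n inord (y0 0 n)) by apply/asboolP; rewrite vK.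
case: (arg_maxP (fun z => w (v z)) P0) => z /asboolP Az zmax.
exists (w (v z)); split; first by exists (v z).
by move=> _ [y Ay <-]; rewrite -(vK _ Ay); apply: zmax; apply/asboolP; rewrite vK.
Qed.

Lemma shares_polymatroid (R : realType) (N M : nat) (f : {set 'I_N} -> R)
    (y : 'rV[nat]_N) :
  (0 < M)%N -> integral_polymatroid (quantized_rank f M) y ->
  polymatroid f (shares R M y).
Proof.
move=> M0 yP; split => [n|S]; first by rewrite mxE divr_ge0.
under eq_bigr do rewrite mxE.
rewrite -mulr_suml ler_pdivrMr ?ltr0n//.
by have := yP S; rewrite (le_quantized_rank M f) rmorph_sum.
Qed.

Theorem theorem3p10 (R : realType) (N : nat) (f : {set 'I_N} -> R) (M : nat)
    (alpha beta : R)
    (hN : (2 <= N)%N)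
    (hf : rank_function f)
    (hf1 : f [set: 'I_N]%SET = 1)
    (hD : 0 < min_distance f)
    (hM : 2 / min_distance f <= M%:R)
    (halpha : 0 < alpha)
    (hbeta : 0 < beta)
    (u : 'I_N -> R -> R)
    (hu : forall n, utility alpha beta (u n)) :
  exists Wq Wopt : R,
    [/\ is_max [set welfare u (shares R M y)
                 | y in integral_polymatroid (quantized_rank f M)] Wq,
        is_max [set welfare u x | x in polymatroid f] Wopt &
        Wq / Wopt >=
          (M%:R * beta + 2 * (alpha - beta)) /
          (M%:R * alpha + 2 * (alpha - beta)
             - Num.max (M%:R - N%:R + 1) 0 * (alpha - beta))].
Proof.
have M0 : 0 < M%:R :> R by rewrite ltr0n (M_gt0 hN hf hf1 hD hM).
have [Wq Wq_max] := bounded_nat_max_exists (fun y => welfare u (shares R M y))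
  (ex_intro _ _ (ones_polymatroid hN hf hD hM))
  (fun y yP n => integral_polymatroid_le hf hf1 n yP).
have [Wopt Wopt_max] := welfare_max_exists hf hf1 halpha hbeta hu.
exists Wq, Wopt; split => //.
have [_ Wq_ub] := Wq_max; have [[x xP xW] Wopt_ub] := Wopt_max.
have NM : N%:R <= M%:R :> R by rewrite ler_nat (leN_M hN hf hf1 hD hM).
have N2 : 2 <= N%:R :> R by rewrite ler_nat.
pose phi n t := u n t - beta * t.
have slope n (s t : R) : 0 <= s -> s <= t -> t <= 1 ->
    beta * (t - s) <= u n t - u n s <= alpha * (t - s) by exact: utility_slope.
have ab : 0 <= alpha - beta.
  have i0 : 'I_N by exists 0%N; apply: leq_trans hN.
  have /andP[] := slope i0 0 1 (lexx 0) ler01 (lexx 1).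
  by rewrite subr0 !mulr1; lra.
have phi0 n (t : R) : 0 <= t -> t <= 1 -> 0 <= phi n t.
  move=> t0 t1; have [unn _ _ _ _] := hu n.
  have := unn 0; rewrite in_itv/= lexx ler01 => /(_ isT).
  by have /andP[] := slope n 0 t (lexx 0) t0 t1; rewrite /phi; lra.
have phi_mono n (s t : R) : 0 <= s -> s <= t -> t <= 1 -> phi n s <= phi n t.
  by move=> s0 st t1; have /andP[] := slope n s t s0 st t1; rewrite /phi; lra.
have phi_lip n (s t : R) : 0 <= s -> s <= t -> t <= 1 ->
    phi n t - phi n s <= (alpha - beta) * (t - s).
  by move=> s0 st t1; have /andP[] := slope n s t s0 st t1; rewrite /phi; lra.
have phi_conc n (s t h : R) : 0 <= s -> s <= t -> 0 <= h -> t + h <= 1 ->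
    phi n (t + h) - phi n t <= phi n (s + h) - phi n s.
  move=> s0 st h0 th; have := utility_increment_nonincreasing (hu n) s0 st h0 th.
  by rewrite /phi; lra.
have W_phi (v : 'rV[R]_N) : welfare u v = \sum_n phi n (v 0 n) + beta * \sum_n v 0 n.
  by rewrite sumrB mulr_sumr subrK.
have Q_ub y : integral_polymatroid (quantized_rank f M) y ->
    \sum_n phi n ((y 0 n)%:R / M%:R) <= Wq - beta.
  (* Passing to a point [z] of total [M] above [y] makes the linear part exactly [beta], while the
     [phi] part can only grow. *)
  move=> yP; have [z [zP yz zs]] := base_exists hf hf1 hD hM yP.
  have : welfare u (shares R M z) <= Wq by apply: Wq_ub; exists z.
  rewrite W_phi; under [X in _ + beta * X]eq_bigr do rewrite mxE.
  rewrite -mulr_suml zs divff ?gt_eqF// mulr1 -lerBrDr; apply: le_trans.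
  apply: ler_sum => n _; rewrite mxE; apply: phi_mono.
  - by rewrite divr_ge0.
  - by rewrite ler_pM2r ?invr_gt0// ler_nat.
  - by rewrite ler_pdivrMr// mul1r ler_nat (integral_polymatroid_le hf hf1).
have lossL := loss_le_lipschitz hN hf hf1 hD hM phi_mono phi_lip Q_ub ab xP.
have lossW := loss_le_welfare hN hf hf1 hD hM phi0 phi_mono phi_conc Q_ub xP.
have Qge0 := Q_ge0 hN hf hf1 hD hM phi0 Q_ub.
have WoptS : Wopt <= \sum_n phi n (x 0 n) + beta.
  rewrite -xW W_phi lerD2l -[leRHS]mulr1 ler_pM2l// -hf1.
  by apply: le_trans (xP.2 _); rewrite [leRHS](eq_bigl predT)// => n; rewrite inE.
(* With [Qge0] this yields [beta <= Wopt], so [Wopt] is positive and the quotient can be cleared. *)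
have WqWopt : Wq <= Wopt.
  have [[y yP <-] _] := Wq_max; apply: Wopt_ub; exists (shares R M y) => //.
  by apply: shares_polymatroid => //; rewrite -(ltr_nat R).
move: lossL lossW WoptS; set S := \sum_n _ => lossL lossW WoptS.
rewrite max_l; last by lra.
have -> : M%:R * alpha + 2 * (alpha - beta) - (M%:R - N%:R + 1) * (alpha - beta)
    = M%:R * beta + (N%:R + 1) * (alpha - beta) by ring.
have Mb : 0 < M%:R * beta by rewrite mulr_gt0.
have Ng : 0 <= (N%:R + 1) * (alpha - beta) by apply: mulr_ge0 => //; lra.
rewrite ler_pdivrMr; last by lra.
rewrite mulrAC ler_pdivlMr; last by lra.
(* Put [D = S - (Wq - beta)]. After [Wopt] is replaced by [S + beta], the goal becomes [(M * beta +
   2 * (alpha - beta)) * D <= (N - 1) * (alpha - beta) * Wq]. It is the sum of [lossL] scaled by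
   [M * beta] and [lossW] scaled by [alpha - beta]. *)
have g2 : 0 <= 2 * (alpha - beta) by lra.
have : (M%:R * beta + 2 * (alpha - beta)) * Wopt <=
    (M%:R * beta + 2 * (alpha - beta)) * (S + beta) by apply: ler_wpM2l => //; lra.
have := ler_wpM2l ab lossW.
have : beta * (M%:R * (S - (Wq - beta))) <= beta * ((N%:R - 1) * (alpha - beta)).
  by rewrite ler_pM2l// mulrC -ler_pdivlMr.
lra.
Qed.
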